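(* Let $W=R_{i_1}^{(k_1)\epsilon_1}R_{i_2}^{(k_2)\epsilon_2}\cdots R_{i_{2n}}^{(k_{2n})\epsilon_{2n}}$ with $k_j\in\mathbb N_0$, $\epsilon_j\in\{*,1\}$, be a multidimensional Dyck word. Then $$\rho(W)=I_c(\Gamma_w;\mathbf x),$$ where $\Gamma_w$ is the digraph $\Gamma$ of the word with vertex weights $w(v_r)=k_{p(r)}+1+k_{\pi(p(r))}$, and $\mathbf x=(x_1,x_2,\dots)$ with $x_1=1$ and $x_k=\sum_{i=1}^\infty\alpha_i^k$ for $k\ge2$.
   Context: Let $\alpha_1\ge\alpha_2\ge\dots\ge0$ with $\sum_i\alpha_i=1$. Let $\mathbb X_n=\mathbb N^n$, $\alpha_x=\prod_i\alpha_{x_i}$, $(\sigma x)_i=x_{\sigma^{-1}(i)}$, $\tilde{\mathbb X}_n=\{(x,y):y\in\mathfrak S_nx\}$. $V_n$ has orthogonal basis $b_{x,y}$, $(x,y)\in\tilde{\mathbb X}_n$, $\langle b_{x',y'},b_{x'',y''}\rangle=\delta(x',x'')\delta(y',y'')\alpha_{x'}$, $U_n(\sigma)b_{x,y}=b_{\sigma x,y}$; $V_0=\mathbb C\Omega$ with $\Omega$ a unit vector. For a complex Hilbert space $\mathcal H$ with orthonormal basis $(e_i)$, $v\otimes_s\eta=\frac1{n!}\sum_\sigma U_n(\sigma)v\otimes\tilde U_n(\sigma)\eta$ ($\tilde U_n$ permutes tensor factors); the Fock space is the Hilbert direct sum of the $\mathfrak S_n$-invariant subspaces $V_n\otimes_s\mathcal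 H^{\otimes n}$, the $n$-th with inner product scaled by $1/n!$, and $\rho(X)=\langle\Omega,X\Omega\rangle$. Weighted right creation operators $R^{(k)}(\xi)\,b_{x,y}\otimes_s\xi_1\otimes\cdots\otimes\xi_n=(n+1)\sum_{z\in\mathbb N}\alpha_z^k\,b_{xz,yz}\otimes_s\xi_1\otimes\cdots\otimes\xi_n\otimes\xi$, with adjoints $R^{(k)}(\xi)^*\,b_{x,y}\otimes_s\xi_1\otimes\cdots\otimes\xi_n=\frac1n\sum_{i=1}^n\delta(x_i,y_n)\alpha_{x_i}^{k+1}\langle\xi_i,\xi\rangle\,b_{x_1\cdots\check x_i\cdots x_n,y_1\cdots y_{n-1}}\otimes_s\xi_1\otimes\cdots\check\xi_i\cdots\otimes\xi_n$. $R_i^{(k)1}=R^{(k)}(e_i)$, $R_i^{(k)*}=R^{(k)}(e_i)^*$. $W$ is a multidimensional Dyck word if for every color $i$ and $0\le j\le2n$ the number of $l>j$ with $i_l=i,\epsilon_l=1$ is at least the number of $l>j$ with $i_l=i,\epsilon_l=*$, with equality for $j=0$. Let $p(1)<\dots<p(n)$ be the positions with $\epsilon=*$, $\pi$ the unique noncrossing pair partition of $\{1,\dots,2n\}$ with pairs $\{p<q\}$, $\epsilon_p=*,\epsilon_q=1$, and $\pi(p)$ the partner of $p$. $\Gamma$ has vertices $v_1,\dots,v_n$ and an edge $v_r\to v_s$ (loops allowed) iff $i_{p(r)}=i_{\pi(p(s))}$ and $\pi(p(s))>p(r)$. For vertex weights $w$, the weight of a directed cycle $\gamma$ is $w(\gamma)=\sum_{v\in\gamma}w(v)$,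 and the cycle indicator polynomial is $I_c(\Gamma_w;\mathbf x)=\sum_C\prod_{\gamma\in C}x_{w(\gamma)}$, summed over all cycle covers $C$ of $\Gamma$ (sets of vertex-disjoint directed cycles, loops being cycles of length 1, covering all vertices). *)

(* Defs.v *)
From HB Require Import structures.
From mathcomp Require Import all_boot all_order all_algebra all_fingroup.
From mathcomp Require Import complex.
From mathcomp Require Import boolp classical_sets functions reals ereal.
From mathcomp Require Import topology normedtype sequences esum.
From mathcomp Require Import finmap.
From mathcomp Require summability.

Set Implicit Arguments.
Unset Strict Implicit.
Unset Printing Implicit Defensive.

Import Order.TTheory GRing.Theory Num.Theory.
Import numFieldNormedType.Exports.

Local Open Scope classical_set_scope.
Local Open Scope ring_scope.
Local Open Scope complex_scope.

(* Unordered sum of a family of scalars. *)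
Definition usum (K : numFieldType) (T : choiceType) (f : T -> K) : K :=
  summability.sum f.

Definition nsum (K : numFieldType) (f : nat -> K) : K := limn (series f).

Section Hilbert.
Variable R : realType.

(* Inner products are linear in their first argument: only then is the formula
   for R^(k)(xi)^*, which contains <xi_i, xi>, antilinear in xi. *)
Record hilbert := Hilbert {
  hcarrier :> lmodType R[i];
  hdot : hcarrier -> hcarrier -> R[i];
  hdotDl : forall a u v w, hdot (a *: u + v) w = a * hdot u w + hdot v w;
  hdotC : forall u v, hdot v u = (hdot u v)^*;
  hdot_ge0 : forall u, 0 <= hdot u u;
  hdot_eq0 : forall u, hdot u u = 0 -> u = 0;
  hcomplete : forall s : nat -> hcarrier,
    let dist u v := Num.sqrt (complex.Re (hdot (u - v) (u - v))) in
    (forall eps, 0 < eps -> exists N, forall m n,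
       (N <= m)%N -> (N <= n)%N -> dist (s m) (s n) < eps) ->
    exists l, forall eps, 0 < eps -> exists N, forall n,
       (N <= n)%N -> dist (s n) l < eps }.

Definition hnorm (H : hilbert) (u : H) : R :=
  Num.sqrt (complex.Re (hdot u u)).

Definition orthonormal_basis (H : hilbert) (I : choiceType) (e : I -> H) :=
  (forall i j, hdot (e i) (e j) = (i == j)%:R) /\
  (forall (v : H) (eps : R), 0 < eps ->
    exists (s : seq I) (a : I -> R[i]),
      hnorm (v - \sum_(i <- s) a i *: e i) < eps).

End Hilbert.

Section Tuples.
Variable T : Type.

Definition tact n (s : 'S_n) (x : n.-tuple T) : n.-tuple T :=
  [tuple tnth x ((s^-1)%g i) | i < n].

Definition tsnoc n (x : n.-tuple T) (z : T) : n.+1.-tuple T :=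
  [tuple of rcons x z].

Definition tlast n (x : n.+1.-tuple T) : T := tnth x ord_max.

Definition tdel n (i : 'I_n.+1) (x : n.+1.-tuple T) : n.-tuple T :=
  [tuple tnth x (lift i j) | j < n].

Definition tset n (i : 'I_n) (x : n.-tuple T) (z : T) : n.-tuple T :=
  [tuple if j == i then z else tnth x j | j < n].

Definition tinit n (x : n.+1.-tuple T) : n.-tuple T := tdel ord_max x.

End Tuples.

Section Fock.
Variables (R : realType) (alpha : nat -> R).

Definition alpha_word n (x : n.-tuple nat) : R :=
  \prod_(i < n) alpha (tnth x i).

(* A vector of V_n is given by its coefficients in the basis b_{x,y}; only the
   values at pairs (x, y) with perm_eq x y, i.e. y in S_n x, are relevant. *)
Definition Vspace n := n.-tuple nat -> n.-tuple nat -> R[i].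

Definition bvec n (x y : n.-tuple nat) : Vspace n :=
  fun x' y' => ((x' == x) && (y' == y))%:R.

Definition Vdot n (v w : Vspace n) : R[i] :=
  usum (fun t : n.-tuple nat * n.-tuple nat =>
    if perm_eq t.1 t.2
    then (alpha_word t.1)%:C * v t.1 t.2 * (w t.1 t.2)^* else 0).

Definition Uop n (s : 'S_n) (v : Vspace n) : Vspace n :=
  fun x y => v (tact s^-1 x) y.

Variable H : hilbert R.

(* The Hilbert tensor power of H is realized by Hilbert-Schmidt functionals
   that are conjugate-linear in each of their n arguments; the elementary
   tensor xi_1 (x) ... (x) xi_n is eta |-> \prod_j <xi_j, eta_j>. *)
Definition VHspace n :=
  n.-tuple nat -> n.-tuple nat -> n.-tuple H -> R[i].

Definition tens n (v : Vspace n) (xi : n.-tuple H) : VHspace n :=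
  fun x y eta => v x y * \prod_(j < n) hdot (tnth xi j) (tnth eta j).

Definition stens n (v : Vspace n) (xi : n.-tuple H) : VHspace n :=
  fun x y eta =>
    (n`!%:R)^-1 * \sum_(s : 'S_n) tens (Uop s v) (tact s xi) x y eta.

(* U_n(s) (x) U~_n(s) on V_n (x) H^{(x) n}. *)
Definition UUop n (s : 'S_n) (u : VHspace n) : VHspace n :=
  fun x y eta => u (tact s^-1 x) y (tact s^-1 eta).

Definition symm n (u : VHspace n) : VHspace n :=
  fun x y eta => (n`!%:R)^-1 * \sum_(s : 'S_n) UUop s u x y eta.

(* v (x) eta |-> (j v) (x) eta (x) xi, where
   j b_{x,y} = \sum_z alpha_z^k b_{xz,yz}. *)
Definition append k (xi : H) n (u : VHspace n) : VHspace n.+1 :=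
  fun x y eta => if tlast x == tlast y
    then (alpha (tlast x) ^+ k)%:C * u (tinit x) (tinit y) (tinit eta)
           * hdot xi (tlast eta)
    else 0.

Definition creation_level k (xi : H) n (u : VHspace n) : VHspace n.+1 :=
  fun x y eta => n.+1%:R * symm (append k xi u) x y eta.

(* The adjoint of append; on symmetric tensors it is the adjoint of
   creation_level for the inner products scaled by 1 / n!. *)
Definition annihilation_level k (xi : H) n (u : VHspace n.+1) : VHspace n :=
  fun x y eta => nsum (fun z =>
    (alpha z ^+ k.+1)%:C * u (tsnoc x z) (tsnoc y z) (tsnoc eta xi)).

Definition fock_vector := forall n, VHspace n.

Definition Omega : fock_vector :=
  fun n _ _ _ => (n == 0%N)%:R.

Definition creation k (xi : H) (u : fock_vector) : fock_vector :=
  fun n => if n is m.+1 then creation_level k xi (u m) else fun _ _ _ => 0.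

Definition annihilation k (xi : H) (u : fock_vector) : fock_vector :=
  fun n => annihilation_level k xi (u n.+1).

Variables (I : choiceType) (e : I -> H).

Definition VHdot n (u v : VHspace n) : R[i] :=
  usum (fun t : n.-tuple nat * n.-tuple nat * n.-tuple I =>
    let x := t.1.1 in let y := t.1.2 in let c := map_tuple e t.2 in
    if perm_eq x y then (alpha_word x)%:C * u x y c * (v x y c)^* else 0).

Definition VHnorm2 n (u : VHspace n) : \bar R :=
  (\esum_(t in [set t : n.-tuple nat * n.-tuple nat * n.-tuple I |
                  perm_eq t.1.1 t.1.2])
     (alpha_word t.1.1 * complex.Re (`|u t.1.1 t.1.2 (map_tuple e t.2)| ^+ 2))%:E)%E.

(* The S_n-invariant elements of V_n (x) H^{(x) n}. *)
Definition sym_level n (u : VHspace n) : Prop :=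
  [/\ forall (x y : n.-tuple nat) eta, ~~ perm_eq x y -> u x y eta = 0,
      forall x y eta i a h h',
        u x y (tset i eta (a *: h + h')) =
          a^* * u x y (tset i eta h) + u x y (tset i eta h'),
      forall x y, exists M : R, forall eta,
        `|u x y eta| <= (M * \prod_(j < n) hnorm (tnth eta j))%:C,
      (VHnorm2 u < +oo)%E &
      forall s, UUop s u = u].

(* Vectors differing only where alpha_x = 0 are at distance 0 and represent
   the same element.  The creation and annihilation operators are unbounded;
   they act on the u with u n = 0 for all but finitely many n, and their
   formulas make sense for arbitrary families. *)
Definition fock_space : set fock_vector :=
  [set u : fock_vector | (forall n, sym_level (u n)) /\
     (\sum_(0 <= n <oo) (((n`!%:R)^-1)%:E * VHnorm2 (u n)) < +oo)%E].

Definition fock_dot (u v : fock_vector) : R[i] :=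
  nsum (fun n => (n`!%:R)^-1 * VHdot (u n) (v n)).

Definition rho (X : fock_vector -> fock_vector) : R[i] :=
  fock_dot Omega (X Omega).

End Fock.

(* The letter R_i^{(k)*} (if lstar) or R_i^{(k)1} (otherwise). *)
Record letter (I : Type) := Letter { lcolor : I; lexp : nat; lstar : bool }.

Definition letter_op (R : realType) (alpha : nat -> R) (H : hilbert R)
    (I : Type) (e : I -> H) (a : letter I) : fock_vector H -> fock_vector H :=
  if lstar a then annihilation alpha (lexp a) (e (lcolor a))
  else creation alpha (lexp a) (e (lcolor a)).

(* The leftmost letter is applied last. *)
Definition word_op (R : realType) (alpha : nat -> R) (H : hilbert R)
    (I : Type) (e : I -> H) (w : seq (letter I))
    : fock_vector H -> fock_vector H :=
  foldr (fun a X => letter_op alpha e a \o X) id w.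


Section CycleIndicator.
Variables (T : finType) (edge : rel T).

(* A directed cycle is identified with its set of arcs; distinct cycles may
   have the same vertices. *)
Definition cycle_arcs (c : seq T) : {set T * T} :=
  [set (v, next c v) | v in c].

Definition directed_cycle (g : {set T * T}) : bool :=
  `[< exists c : seq T,
        [/\ c != [::], uniq c, path.cycle edge c & g = cycle_arcs c] >].

Definition cycle_vertices (g : {set T * T}) : {set T} := [set a.1 | a in g].

Definition cycle_cover (C : {set {set T * T}}) : bool :=
  [&& [forall g in C, directed_cycle g],
      [forall g in C, forall h in C,
         (g != h) ==> [disjoint cycle_vertices g & cycle_vertices h]] &
      [forall v, exists g in C, v \in cycle_vertices g]].

Definition cycle_weight (w : T -> nat) (g : {set T * T}) : nat :=
  (\sum_(v in cycle_vertices g) w v)%N.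

Definition cycle_indicator (A : comNzRingType) (w : T -> nat) (x : nat -> A) : A :=
  \sum_(C : {set {set T * T}} | cycle_cover C)
    \prod_(g in C) x (cycle_weight w g).

End CycleIndicator.

Section DyckWords.
Variables (I : choiceType) (n : nat) (W : n.*2.-tuple (letter I)).

(* Positions are numbered from 0, so that l > j becomes j <= l. *)
Definition count_letters (i : I) (st : bool) (j : nat) : nat :=
  #|[set l : 'I_n.*2 | [&& (j <= l)%N, lcolor (tnth W l) == i
                         & lstar (tnth W l) == st]]|.

Definition dyck_word : Prop :=
  forall i : I,
    (forall j, (j <= n.*2)%N ->
       (count_letters i true j <= count_letters i false j)%N) /\
    count_letters i true 0 = count_letters i false 0.

Definition star_enum (p : 'I_n -> 'I_n.*2) : Prop :=
  {homo p : r s / (r < s)%N} /\ (forall l, lstar (tnth W l) = (l \in codom p)).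

(* Pair partitions are represented by the map exchanging the two elements of
   each pair. *)
Definition noncrossing_pairing (pi : 'I_n.*2 -> 'I_n.*2) : Prop :=
  [/\ forall l, pi (pi l) = l,
      forall l, lstar (tnth W l) -> (l < pi l)%N,
      forall l, lstar (tnth W (pi l)) = ~~ lstar (tnth W l) &
      forall a b : 'I_n.*2, ~~ [&& (a < b)%N, (b < pi a)%N & (pi a < pi b)%N]].

Definition word_edge (p : 'I_n -> 'I_n.*2) (pi : 'I_n.*2 -> 'I_n.*2)
    : rel 'I_n :=
  fun r s =>
    (lcolor (tnth W (p r)) == lcolor (tnth W (pi (p s)))) &&
    (p r < pi (p s))%N.

Definition word_weight (p : 'I_n -> 'I_n.*2) (pi : 'I_n.*2 -> 'I_n.*2)
    (r : 'I_n) : nat :=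
  (lexp (tnth W (p r)) + 1 + lexp (tnth W (pi (p r))))%N.

End DyckWords.

Definition power_sums (R : realType) (alpha : nat -> R) (k : nat) : R :=
  if k == 1%N then 1 else limn (series (fun i => alpha i ^+ k)).
Lemma nsum_single (K : numFieldType) (f : nat -> K) z0 :
  (forall z, z != z0 -> f z = 0) -> nsum f = f z0.
Proof.
move=> f0; rewrite /nsum; apply: cvg_lim; first exact: norm_hausdorff.
apply: cvg_near_cst; exists z0.+1 => // N /= ltN.
rewrite /series /= big_mkord.
by rewrite (bigD1 (Ordinal ltN)) //= big1 ?addr0 // => i ne; apply: f0.
Qed.

Lemma usum_single (K : numFieldType) (T : choiceType) (f : T -> K) t0 :
  (forall t, t != t0 -> f t = 0) -> usum f = f t0.
Proof.
move=> f0; rewrite /usum /summability.sum.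
have FT := @summability.totally_filter T.
apply: cvg_lim; first exact: norm_hausdorff.
apply: cvg_near_cst.
exists [fset t0]%fset => // A /=; rewrite fsub1set => At0.
rewrite /summability.partial_sum (bigD1 [` At0]%fset) //= big1 ?addr0 // => i ne.
by apply: f0; apply: contra ne => /eqP h; apply/eqP/val_inj.
Qed.

Lemma widen_lift_max n (j : 'I_n) :
  widen_ord (leqnSn n) j = lift ord_max j.
Proof. by apply: ord_inj; rewrite lift_max. Qed.

Section TupleLemmas.
Variable T : Type.

Lemma tnth_tact n (s : 'S_n) (x : n.-tuple T) i :
  tnth (tact s x) i = tnth x ((s^-1)%g i).
Proof. by rewrite tnth_mktuple. Qed.

Lemma tactM n (s t : 'S_n) (x : n.-tuple T) :
  tact s (tact t x) = tact (t * s)%g x.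
Proof. by apply: eq_from_tnth => i; rewrite !tnth_tact invMg permM. Qed.

Lemma tact1 n (x : n.-tuple T) : tact 1%g x = x.
Proof. by apply: eq_from_tnth => i; rewrite tnth_tact invg1 perm1. Qed.

Lemma tactK n (s : 'S_n) : cancel (@tact T n s) (tact s^-1).
Proof. by move=> x; rewrite tactM mulgV tact1. Qed.

Lemma tactVK n (s : 'S_n) : cancel (@tact T n s^-1) (tact s).
Proof. by move=> x; rewrite tactM mulVg tact1. Qed.

Lemma tlast_tsnoc n (x : n.-tuple T) z : tlast (tsnoc x z) = z.
Proof.
by rewrite /tlast (tnth_nth z) /= nth_rcons size_tuple ltnn eqxx.
Qed.

Lemma tnth_tsnoc n (x : n.-tuple T) z j :
  tnth (tsnoc x z) (lift ord_max j) = tnth x j.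
Proof.
by rewrite !(tnth_nth z) lift_max /= nth_rcons size_tuple ltn_ord.
Qed.

Lemma tnth_tdel n i (x : n.+1.-tuple T) j :
  tnth (tdel i x) j = tnth x (lift i j).
Proof. by rewrite tnth_mktuple. Qed.

Lemma tinit_tsnoc n (x : n.-tuple T) z : tinit (tsnoc x z) = x.
Proof. by apply: eq_from_tnth => j; rewrite tnth_tdel tnth_tsnoc. Qed.

Lemma tsnocK n (x : n.+1.-tuple T) : tsnoc (tinit x) (tlast x) = x.
Proof.
apply: eq_from_tnth => i; case: (unliftP ord_max i) => [j|] ->.
  by rewrite tnth_tsnoc tnth_tdel.
exact: tlast_tsnoc.
Qed.

Lemma tact_lift_perm n i (s : 'S_n) (x : n.+1.-tuple T) :
  tact (lift_perm i ord_max s) x = tsnoc (tact s (tdel i x)) (tnth x i).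
Proof.
apply: eq_from_tnth => l; rewrite tnth_tact lift_permV.
case: (unliftP ord_max l) => [j|] ->.
  by rewrite lift_perm_lift tnth_tsnoc tnth_tact tnth_tdel.
by rewrite lift_perm_id [RHS]tlast_tsnoc.
Qed.

End TupleLemmas.

Lemma eq_tsnoc (T : eqType) n (x : n.+1.-tuple T) x' z :
  (x == tsnoc x' z) = (tinit x == x') && (tlast x == z).
Proof.
apply/eqP/andP => [->|[/eqP<- /eqP<-]]; last by rewrite tsnocK.
by rewrite tinit_tsnoc tlast_tsnoc !eqxx.
Qed.

Section ActionFormulas.
Variables (R : realType) (alpha : nat -> R) (H : hilbert R).

Lemma Uop_bvec n (s : 'S_n) (x y : n.-tuple nat) :
  Uop s (bvec R x y) = bvec R (tact s x) y.
Proof.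
apply/funext => x'; apply/funext => y'; rewrite /Uop /bvec.
congr ((_ && _)%:R); apply/eqP/eqP => [<-|->]; first by rewrite tactVK.
by rewrite tactK.
Qed.

Lemma Vdot_bvec n (x y x' y' : n.-tuple nat) : perm_eq x y ->
  Vdot alpha (bvec R x y) (bvec R x' y') =
    (x == x')%:R * (y == y')%:R * (alpha_word alpha x)%:C.
Proof.
move=> pxy; rewrite /Vdot (usum_single (t0 := (x, y))) /=; last first.
  move=> [a b]; rewrite xpair_eqE /bvec /= => /negbTE ->.
  by rewrite mulr0 mul0r if_same.
rewrite pxy /bvec !eqxx mulr1 -natrM mulnb mulrC; congr (_ * _).
exact: rmorph_nat.
Qed.

Lemma tens_UUop n (s : 'S_n) (v : Vspace R n) (xi : n.-tuple H) :
  tens (Uop s v) (tact s xi) = UUop s (tens v xi).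
Proof.
apply/funext => x; apply/funext => y; apply/funext => eta.
rewrite /tens /UUop /Uop; congr (_ * _).
rewrite (reindex_inj (@perm_inj _ s)); apply: eq_bigr => j _.
by rewrite !tnth_tact invgK permK.
Qed.

Lemma stens_symm n (v : Vspace R n) (xi : n.-tuple H) :
  stens v xi = symm (tens v xi).
Proof.
apply/funext => x; apply/funext => y; apply/funext => eta.
by rewrite /stens /symm; congr (_ * _); apply: eq_bigr => s _; rewrite tens_UUop.
Qed.

Lemma append_stens k (xi : H) n (v : Vspace R n) (xs : n.-tuple H) :
  append alpha k xi (stens v xs) = fun x y eta =>
    (n`!%:R)^-1 * \sum_(s : 'S_n)
      UUop (lift_perm ord_max ord_max s)
        (append alpha k xi (tens v xs)) x y eta.
Proof.
apply/funext => x; apply/funext => y; apply/funext => eta.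
rewrite /append /stens.
have E (s : 'S_n) (T : Type) (t : n.+1.-tuple T) :
    tact (lift_perm ord_max ord_max s)^-1 t = tsnoc (tact s^-1 (tinit t)) (tlast t).
  by rewrite lift_permV tact_lift_perm.
rewrite /UUop; case: ifP => h; last first.
  rewrite big1 ?mulr0 // => s _; by rewrite E tlast_tsnoc h.
rewrite mulrCA -mulrA mulr_sumr mulr_suml; congr (_ * _).
apply: eq_bigr => s _; rewrite !E !tlast_tsnoc !tinit_tsnoc h tens_UUop.
by rewrite /UUop mulrA.
Qed.

Lemma symm_UUop n (s : 'S_n) (u : VHspace H n) : symm (UUop s u) = symm u.
Proof.
apply/funext => x; apply/funext => y; apply/funext => eta.
rewrite /symm; congr (_ * _).
rewrite [RHS](reindex_inj (mulgI s)) /=; apply: eq_bigr => t _.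
by rewrite /UUop !tactM invMg.
Qed.

Lemma symm_append_stens k (xi : H) n (v : Vspace R n) (xs : n.-tuple H) :
  symm (append alpha k xi (stens v xs)) = symm (append alpha k xi (tens v xs)).
Proof.
rewrite append_stens; apply/funext => x; apply/funext => y; apply/funext => eta.
rewrite /symm /=.
rewrite -[in LHS]mulr_sumr mulrCA exchange_big /= mulr_sumr.
transitivity ((n`!%:R)^-1 * \sum_(s : 'S_n) symm (append alpha k xi (tens v xs)) x y eta).
  congr (_ * _); apply: eq_bigr => s _.
  by rewrite -[in RHS](symm_UUop (lift_perm ord_max ord_max s)).
rewrite sumr_const card_Sn -[X in _ * X]mulr_natl mulrA mulVf ?mul1r //.
Qed.

(* R^(k)(xi) on b_{x,y} (x)_s xi_1 (x) ... (x) xi_n. *)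
Lemma creation_bvec k (xi : H) n (x y : n.-tuple nat) (xs : n.-tuple H) :
  creation_level alpha k xi (stens (bvec R x y) xs) = fun x' y' eta =>
    n.+1%:R * nsum (fun z => (alpha z ^+ k)%:C *
      stens (bvec R (tsnoc x z) (tsnoc y z)) (tsnoc xs xi) x' y' eta).
Proof.
apply/funext => x'; apply/funext => y'; apply/funext => eta.
rewrite /creation_level symm_append_stens; congr (_ * _).
rewrite (nsum_single (z0 := tlast y')); last first.
  move=> z ne; rewrite /stens big1 ?mulr0 // => s _.
  by rewrite /tens /Uop /bvec !eq_tsnoc [tlast y' == z]eq_sym (negbTE ne) !andbF mul0r.
rewrite stens_symm /symm mulrCA; congr (_ * _); rewrite mulr_sumr.
apply: eq_bigr => s _; rewrite /UUop; move: (tact s^-1 x') (tact s^-1 eta) => a c.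
rewrite /append /tens /bvec !eq_tsnoc eqxx andbT.
case: eqP => [->|_]; last by rewrite !andbF mul0r mulr0.
rewrite andbT -!mulrA; congr (_ * (_ * _)).
rewrite big_ord_recr /=; congr (_ * _); last first.
  by rewrite -/(tlast c) -/(tlast (tsnoc xs xi)) tlast_tsnoc.
by apply: eq_bigr => j _; rewrite widen_lift_max tnth_tdel tnth_tsnoc.
Qed.

Lemma sum_lift_perm n (F : 'S_n.+1 -> R[i]) :
  \sum_(s : 'S_n.+1) F s =
    \sum_(i < n.+1) \sum_(s : 'S_n) F (lift_perm i ord_max s).
Proof.
rewrite (partition_big (fun s : 'S_n.+1 => (s^-1)%g ord_max) predT) //=.
apply: eq_bigr => i0 _.
rewrite (eq_bigl (fun s : 'S_n.+1 => s i0 == ord_max)); last first.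
  by move=> s; apply/eqP/eqP => [<-|<-]; rewrite ?permKV ?permK.
rewrite (reindex (lift_perm i0 ord_max)); last first.
  pose ulsf i (s : 'S_n.+1) k := odflt k (unlift (s i) (s (lift i k))).
  have ulsfK i (s : 'S_n.+1) k: lift (s i) (ulsf i s k) = s (lift i k).
    rewrite /ulsf; have:= neq_lift i k.
    by rewrite -(can_eq (permK s)) => /unlift_some[] ? ? ->.
  have inj_ulsf: injective (ulsf i0 _).
    move=> s; apply: can_inj (ulsf (s i0) s^-1%g) _ => k'.
    by rewrite {1}/ulsf ulsfK !permK liftK.
  exists (fun s => perm (inj_ulsf s)) => [s _ | s].
    by apply/permP=> k'; rewrite permE /ulsf lift_perm_lift lift_perm_id liftK.
  move/(s _ =P _) => si0; apply/permP=> k.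
  case: (unliftP i0 k) => [k'|] ->; rewrite ?lift_perm_id //.
  by rewrite lift_perm_lift -si0 permE ulsfK.
by apply: eq_bigl => s; rewrite lift_perm_id eqxx.
Qed.

(* R^(k)(xi)^* on b_{x,y} (x)_s xi_1 (x) ... (x) xi_{n+1}. *)
Lemma annihilation_bvec k (xi : H) n (x y : n.+1.-tuple nat)
    (xs : n.+1.-tuple H) :
  annihilation_level alpha k xi (stens (bvec R x y) xs) = fun x' y' eta =>
    n.+1%:R^-1 * \sum_(i < n.+1)
      (tnth x i == tlast y)%:R * (alpha (tnth x i) ^+ k.+1)%:C
        * hdot (tnth xs i) xi
        * stens (bvec R (tdel i x) (tinit y)) (tdel i xs) x' y' eta.
Proof.
apply/funext => x'; apply/funext => y'; apply/funext => eta.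
rewrite /annihilation_level (nsum_single (z0 := tlast y)); last first.
  move=> z ne; rewrite /stens big1 ?mulr0 // => s _.
  rewrite /tens /Uop /bvec [_ == y]eq_sym eq_tsnoc [tlast y == z]eq_sym (negbTE ne).
  by rewrite !andbF mul0r.
rewrite /stens sum_lift_perm mulrCA mulr_sumr factS natrM invfM -mulrA.
congr (_ * _); rewrite mulr_sumr; apply: eq_bigr => i _.
rewrite [RHS]mulrCA; congr (_ * _); rewrite !mulr_sumr; apply: eq_bigr => s _.
rewrite Uop_bvec [in RHS]Uop_bvec !tact_lift_perm /tens /bvec.
rewrite ![tsnoc _ (tlast y) == _]eq_sym !(eq_tsnoc y) eqxx andbT eq_tsnoc.
rewrite tinit_tsnoc tlast_tsnoc [x' == _]eq_sym [y' == _]eq_sym.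
case: (tnth x i =P tlast y) => [->|_]; last by rewrite andbF !mul0r mulr0.
rewrite andbT mul1r -!mulrA; congr (_ * _); rewrite [RHS]mulrCA; congr (_ * _).
rewrite big_ord_recr /= mulrC; congr (_ * _).
  by rewrite -/(tlast (tsnoc eta xi)) -/(tlast (tsnoc _ _)) !tlast_tsnoc.
by apply: eq_bigr => j _; rewrite widen_lift_max !tnth_tsnoc.
Qed.

Lemma usum0 (K : numFieldType) (T : choiceType) : usum (fun _ : T => 0 : K) = 0.
Proof.
rewrite /usum /summability.sum.
have FT := @summability.totally_filter T.
apply: cvg_lim; first exact: norm_hausdorff.
by apply: cvg_near_cst; apply: nearW => A; rewrite /summability.partial_sum big1.
Qed.

Variables (I : choiceType) (e : I -> H).

Lemma rhoE (X : fock_vector H -> fock_vector H) :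
  rho alpha e X =
    (X (@Omega R H) 0%N [tuple] [tuple] [tuple])^*.
Proof.
rewrite /rho /fock_dot (nsum_single (z0 := 0%N)); last first.
  move=> n n0; rewrite /VHdot /Omega (negbTE n0).
  under [X in usum X]funext do rewrite mulr0 mul0r if_same.
  by rewrite usum0 mulr0.
rewrite fact0 invr1 mul1r /VHdot.
rewrite (usum_single (t0 := ([tuple], [tuple], [tuple]))) /=; last first.
  by move=> [[x y] c] /negP[]; rewrite (tuple0 x) (tuple0 y) (tuple0 c).
rewrite /alpha_word big_ord0 {1}/Omega mulr1 mul1r.
by congr ((X _ _ _ _ _)^*); rewrite tuple0.
Qed.

Lemma Omega_unit : fock_dot alpha e (@Omega R H) (@Omega R H) = 1.
Proof. by rewrite -[LHS]/(rho alpha e id) rhoE; apply: rmorph1. Qed.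

Lemma Omega_fock : fock_space alpha e (@Omega R H).
Proof.
have N0 n : n != 0%N -> VHnorm2 alpha e (@Omega R H n) = 0%E.
  move=> n0; rewrite /VHnorm2 esum1 // => t _.
  by rewrite /Omega (negbTE n0) normr0 expr0n /= mulr0.
have N1 : VHnorm2 alpha e (@Omega R H 0%N) = 1%E.
  have -> : @Omega R H 0%N = (fun _ _ _ => 1) by [].
  rewrite /VHnorm2 (_ : [set t | _] = [set ([tuple], [tuple], [tuple])]).
    have E : (alpha_word alpha [tuple] *
        complex.Re (`|1 : R[i]| ^+ 2)) = 1 :> R.
      by rewrite /alpha_word big_ord0 mul1r normr1 expr1n.
    by rewrite esum_set1 /= E // lee_fin ler01.
  apply/seteqP; split => [[[x y] c] _ | _ ->] //=.
  by rewrite (tuple0 x) (tuple0 y) (tuple0 c).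
split.
  case=> [|n]; split.
  - by move=> x y eta; rewrite (tuple0 x) (tuple0 y) perm_refl.
  - by move=> ? ? ? [].
  - by move=> x y; exists 1 => eta; rewrite [Omega _ _ _]/(1 : R[i]) normr1 big_ord0 mulr1.
  - by rewrite N1 ltry.
  - by [].
  - by [].
  - by move=> *; rewrite /Omega mulr0 addr0.
  - by move=> x y; exists 0 => eta; rewrite /Omega normr0 mul0r.
  - by rewrite N0 // ltry.
  - by [].
rewrite nneseries_recl //=; last first.
  move=> [|n] _; first by rewrite N1 fact0 invr1 mule1 lee_fin ler01.
  by rewrite N0 // mule0.
rewrite eseries0 ?adde0; last by move=> [|n] // _ _; rewrite N0 // mule0.
by rewrite N1 fact0 invr1 mule1 ltry.
Qed.

End ActionFormulas.

(* Main.v *)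
Require Import Defs.
From mathcomp Require Import all_boot all_order all_algebra all_fingroup.
From mathcomp Require Import complex.
From mathcomp Require Import boolp.
From mathcomp Require Import classical_sets reals topology normedtype sequences.
From mathcomp Require Import lra.

(** Read from the left and evaluated at the vacuum, an annihilator pushes a
    label z, summed with weight alpha_z^(k+1), on a stack and on a multiset of
    pending labels; a creator pops the stack and removes from the multiset a
    pending label equal to the popped one and of its own color.  The stack pairs
    the creators with the annihilators by pi, while the removals choose a
    permutation s of the stars, i.e. a cycle cover of Gamma, and force the
    labels to be constant on the cycles of s.  Summing over the labels gives one
    power sum per cycle.  The infinite sums over the labels are reached as
    limits of truncations, for which everything is a finite sum. *)

Set Implicit Arguments.
Unset Strict Implicit.
Unset Printing Implicit Defensive.

Import Order.TTheory GRing.Theory Num.Theory.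
Import numFieldNormedType.Exports.
Local Open Scope ring_scope.

(** * Cycle covers as permutations *)

Section CycleCovers.
Variables (T : finType) (edge : rel T).
Implicit Types (s : {perm T}) (c : seq T).

Definition perm_arcs s (A : {set T}) : {set T * T} := [set (v, s v) | v in A].

Definition perm_cycles s : {set {set T * T}} :=
  [set perm_arcs s A | A in porbits s].

Lemma cycle_vertices_arcs s A : cycle_vertices (perm_arcs s A) = A.
Proof.
apply/setP => v; apply/imsetP/idP => [[_ /imsetP[u uA ->] ->] //|vA].
by exists (v, s v) => //; apply: imset_f.
Qed.

Lemma mem_cycle_vertices c v : (v \in cycle_vertices (cycle_arcs c)) = (v \in c).
Proof.
apply/imsetP/idP => [[_ /imsetP[u uc ->] ->] //|vc].
by exists (v, next c v) => //; apply: imset_f.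
Qed.

Lemma cycle_arcs_fcycle s c :
  fcycle s c -> cycle_arcs c = perm_arcs s [set v in c].
Proof.
move=> sc; apply/setP => a; apply/imsetP/imsetP => -[v vc ->]; exists v;
  move: vc; rewrite ?inE // => vc; congr (_, _).
  by have /eqP := next_cycle sc vc.
by have /eqP := next_cycle sc vc.
Qed.

Lemma porbit_fconnect s x y : (y \in porbit s x) = fconnect s x y.
Proof.
apply/porbitP/idP => [[i ->]|/iter_findex <-].
  by rewrite permX; apply: fconnect_iter.
by exists (findex s x y); rewrite permX.
Qed.

Lemma porbit_fcycle s c x :
  uniq c -> fcycle s c -> x \in c -> porbit s x = [set v in c].
Proof.
move=> uc sc xc; apply/setP => y.
by rewrite inE porbit_fconnect (fconnect_cycle sc xc).
Qed.

Lemma fcycle_traject_porbit s x : fcycle s (traject s x #|porbit s x|).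
Proof.
have := iter_porbit s x; have := card_porbit_neq0 s x.
case: #|_| => // m _; rewrite iterSr => im /=.
by rewrite -[X in rcons _ X]im -trajectSr fpath_traject.
Qed.

Lemma cycle_cover_perm_cycles s :
  (forall v, edge v (s v)) -> cycle_cover edge (perm_cycles s).
Proof.
move=> es; apply/and3P; split.
- apply/'forall_implyP => _ /imsetP[_ /imsetP[x _ ->] ->].
  apply/asboolP; exists (traject s x #|porbit s x|).
  have sc := fcycle_traject_porbit s x.
  split; last 2 first.
  + by apply: sub_cycle sc => u _ /eqP <-.
  + rewrite (cycle_arcs_fcycle sc); congr perm_arcs.
    by apply/setP => y; rewrite inE porbit_traject.
  + by have := card_porbit_neq0 s x; case: #|_|.
  + exact: uniq_traject_porbit.
- apply/'forall_implyP => _ /imsetP[_ /imsetP[x _ ->] ->].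
  apply/'forall_implyP => _ /imsetP[_ /imsetP[y _ ->] ->].
  rewrite !cycle_vertices_arcs; apply/implyP; apply: contraR.
  case/pred0Pn => v /andP[/=]; rewrite -!eq_porbit_mem => /eqP <- /eqP <-.
  by rewrite eqxx.
- apply/forallP => v; apply/exists_inP; exists (perm_arcs s (porbit s v)).
    by apply: imset_f; apply: imset_f.
  by rewrite cycle_vertices_arcs porbit_id.
Qed.

(** The only arc of [perm_cycles s] that leaves [v] is [(v, s v)], so the arcs determine [s]. *)
Lemma perm_cycles_inj : injective perm_cycles.
Proof.
move=> s t st; apply/permP => v.
have : perm_arcs s (porbit s v) \in perm_cycles t.
  by rewrite -st; apply: imset_f; apply: imset_f.
case/imsetP => A _ E; have : (v, s v) \in perm_arcs t A.
  by rewrite -E; apply: imset_f; apply: porbit_id.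
by case/imsetP => u _ [-> ->].
Qed.

(** Disjointness and covering leave one outgoing arc at every vertex; the successor map so obtained
    is injective, hence a permutation. *)
Lemma cycle_coverP (C : {set {set T * T}}) :
  reflect (exists2 s : {perm T}, forall v, edge v (s v) & C = perm_cycles s)
          (cycle_cover edge C).
Proof.
apply: (iffP idP) => [|[s es ->]]; last exact: cycle_cover_perm_cycles.
case/and3P => /'forall_implyP dC /'forall_implyP disC /forallP covC.
have share g h v : g \in C -> h \in C -> v \in cycle_vertices g ->
    v \in cycle_vertices h -> g = h.
  move=> gC hC vg vh; apply/eqP; have /'forall_implyP/(_ h hC) := disC g gC.
  apply: contraLR => gh; rewrite negb_imply gh /=.
  by apply/pred0Pn; exists v; rewrite /= vg vh.
have /choice [c cP] : forall v, exists c,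
    [/\ v \in c, uniq c, path.cycle edge c & cycle_arcs c \in C].
  move=> v; have /exists_inP[g gC vg] := covC v.
  have /asboolP[c [_ uc ec gE]] := dC g gC.
  by exists c; split; rewrite // -?gE // -mem_cycle_vertices -gE.
have inc v : v \in c v by case: (cP v).
have uc v : uniq (c v) by case: (cP v).
have cC v : cycle_arcs (c v) \in C by case: (cP v).
have cE u v : u \in c v -> cycle_arcs (c u) = cycle_arcs (c v).
  by move=> uv; apply: (share _ _ u); rewrite ?cC ?mem_cycle_vertices ?inc.
have nextE c1 c2 v : v \in c1 -> cycle_arcs c1 = cycle_arcs c2 ->
    next c1 v = next c2 v.
  move=> vc1 E; have : (v, next c1 v) \in cycle_arcs c2 by rewrite -E imset_f.
  by case/imsetP => u _ [-> ->].
(* The sequences chosen for two vertices of one cycle may be different rotations of it, but their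
   arcs agree and determine [next]. *)
pose f v := next (c v) v.
have fE u v : u \in c v -> f u = next (c v) u.
  by move=> uv; apply: nextE => //; apply: cE.
have f_inj : injective f.
  move=> u v fuv; have fu : f u \in c u by rewrite mem_next.
  have fv : f u \in c v by rewrite fuv mem_next.
  have E : cycle_arcs (c u) = cycle_arcs (c v).
    by rewrite -(cE _ _ fu) -(cE _ _ fv).
  have vu : v \in c u by rewrite -mem_cycle_vertices E mem_cycle_vertices.
  by apply: (can_inj (prev_next (uc u))); rewrite -!fE.
pose s := perm f_inj.
have sc v : fcycle s (c v).
  apply: (@cycle_from_next _ _ _ (uc v)) => u uv /=.
  by rewrite permE (fE _ _ uv).
have arcsE v : cycle_arcs (c v) = perm_arcs s (porbit s v).
  by rewrite (cycle_arcs_fcycle (sc v)) (porbit_fcycle (uc v) (sc v) (inc v)).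
exists s.
  by move=> v; rewrite permE; case: (cP v) => vc _ ec _; apply: next_cycle.
apply/setP => g; apply/idP/imsetP => [gC|[_ /imsetP[x _ ->] ->]].
  have /asboolP[c0 [c00 _ _ gE]] := dC g gC.
  case: c0 c00 gE => // x c0 _ gE.
  exists (porbit s x); first exact: imset_f.
  rewrite -arcsE; apply: (share _ _ x); rewrite ?cC // ?gE mem_cycle_vertices ?inc //.
  exact: mem_head.
by rewrite -arcsE cC.
Qed.

Lemma cycle_indicator_perm (A : comNzRingType) (w : T -> nat) (x : nat -> A) :
  cycle_indicator edge w x =
    \sum_(s : {perm T} | [forall v, edge v (s v)])
      \prod_(O in porbits s) x (\sum_(v in O) w v)%N.
Proof.
rewrite /cycle_indicator.
rewrite (eq_bigl (mem (perm_cycles @: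
  [set s : {perm T} | [forall v, edge v (s v)]]))); last first.
  move=> C; apply/cycle_coverP/imsetP => [[s es ->]|[s]].
    by exists s => //; rewrite inE; apply/forallP.
  by rewrite inE => /forallP es ->; exists s.
rewrite big_imset /=; last by move=> s t _ _; apply: perm_cycles_inj.
apply: eq_big => [s|s _]; first by rewrite inE.
rewrite big_imset /=; last first.
  by move=> O P _ _ OP; rewrite -(cycle_vertices_arcs s O) OP cycle_vertices_arcs.
by apply: eq_bigr => O _; rewrite /cycle_weight cycle_vertices_arcs.
Qed.

Lemma porbit_constant (V : Type) (z : T -> V) s :
  (forall v, z (s v) = z v) -> forall u v, u \in porbit s v -> z u = z v.
Proof.
move=> zs u v /porbitP[i ->]; elim: i => [|i IHi]; first by rewrite expg0 perm1.
by rewrite expgSr permM zs.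
Qed.

(* The labelings that contribute are those constant on the cycles of s. *)
Lemma sum_constant_labelings (A : comNzRingType) N (a : nat -> A)
    (w : T -> nat) s :
  \sum_(z : {ffun T -> 'I_N.+1})
     \prod_r ((z (s r) == z r)%:R * a (z r) ^+ w r) =
  \prod_(O in porbits s) \sum_(j < N.+1) a j ^+ (\sum_(v in O) w v)%N.
Proof.
rewrite (big_distr_big (ord0 : 'I_N.+1)) /=.
rewrite (bigID (fun z : {ffun T -> 'I_N.+1} => [forall r, z (s r) == z r])) /=.
rewrite addrC big1 ?add0r; last first.
  move=> z /forallPn[r /negPf zr]; rewrite (bigD1 r) //=.
  by rewrite zr !mul0r.
(* [h] spreads labels of orbits over the vertices and [h'] reads them back at a picked vertex. Off
   [porbits s] the value is [ord0], the default used in expanding the product of sums. *)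
pose h (f : {ffun {set T} -> 'I_N.+1}) := [ffun r => f (porbit s r)].
pose h' (z : {ffun T -> 'I_N.+1}) : {ffun {set T} -> 'I_N.+1} :=
  [ffun O : {set T} => if O \in porbits s
     then if [pick r in O] is Some r then z r else ord0 else ord0].
rewrite (reindex_onto h h') /=; last first.
  move=> z /forallP zs; apply/ffunP => r; rewrite !ffunE imset_f //.
  case: pickP => [u ur|/(_ r)]; last by rewrite porbit_id.
  by apply: porbit_constant ur => v; apply/eqP.
have porbit_s f r : h f (s r) = h f r.
  by rewrite !ffunE -[s r]/((s ^+ 1)%g r) porbit_perm.
apply: eq_big => [f|f _].
  rewrite (_ : [forall r, _]) /=; last by apply/forallP => r; rewrite porbit_s.
  apply/eqP/pffun_onP => [<-|[/fintype.subsetP fs _]].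
    split=> //; apply/fintype.subsetP => O; rewrite !inE ffunE.
    by case: ifP => //; rewrite eqxx.
  apply/ffunP => O; rewrite ffunE; case: ifP => [/imsetP[x _ ->]|Os].
    case: pickP => [u|/(_ x)]; last by rewrite porbit_id.
    by rewrite ffunE -eq_porbit_mem => /eqP ->.
  by apply/esym/eqP; apply/negPn/negP => /fs; rewrite Os.
rewrite (partition_big (porbit s) (mem (porbits s))) /=; last first.
  by move=> r _; apply: imset_f.
apply: eq_bigr => _ /imsetP[x _ ->]; rewrite expr_sum.
apply: eq_big => r; first by rewrite eq_porbit_mem.
by move=> /eqP E; rewrite porbit_s eqxx mul1r ffunE E.
Qed.

End CycleCovers.

Definition psum (A : pzSemiRingType) N (f : nat -> A) : A :=
  \sum_(j < N.+1) f j.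

(** * The recursion on labels *)

Section Wick.
Variables (A : pzSemiRingType) (I : choiceType).
Variables (S : (nat -> A) -> A) (a : nat -> A).

(* Read from the left, a starred letter pushes a new label, summed by S, on the
   stack y and on the multiset x of pending colored labels; an unstarred letter
   pops the stack and deletes a matching element of x. *)
Fixpoint wick (w : seq (letter I)) (x : seq (nat * I)) (y : seq nat) : A :=
  if w is l :: w' then
    if lstar l then
      S (fun z => a z ^+ (lexp l).+1 * wick w' ((z, lcolor l) :: x) (z :: y))
    else if y is z :: y' then
      (count_mem (z, lcolor l) x)%:R *
        (a z ^+ lexp l * wick w' (rem (z, lcolor l) x) y')
    else 0
  else (x == [::])%:R.

(** The list [x] enters only through its multiplicities, so it can stand for a multiset. *)
Lemma wick_perm w x x' y : perm_eq x x' -> wick w x y = wick w x' y.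
Proof.
elim: w x x' y => [|l w IHw] x x' y xx' /=.
  by rewrite -!size_eq0 (perm_size xx').
case: ifP => _.
  by congr S; apply/funext => z; rewrite (IHw _ ((z, lcolor l) :: x')) // perm_cons.
case: y => // z y; congr (_%:R * (_ * _)); first exact/seq.permP.
apply: IHw; have [zx|zx] := boolP ((z, lcolor l) \in x).
  rewrite -(perm_cons (z, lcolor l)) -(permPl (perm_to_rem zx)).
  by rewrite (permPl xx') perm_to_rem // -(perm_mem xx').
by rewrite !rem_id // -(perm_mem xx').
Qed.

End Wick.

(** * Expansion over labelings and matchings *)

Section WordExpansion.
Variables (I : choiceType) (n : nat) (W : n.*2.-tuple (letter I)).
Variables (p : 'I_n -> 'I_n.*2) (p_enum : star_enum W p).
Variables (pi : 'I_n.*2 -> 'I_n.*2) (pi_nc : noncrossing_pairing W pi).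

(** Creators are indexed by the stars paired with them, so a matching of creators with stars becomes
    a self-map of the indices. *)
Let q r := pi (p r).

Lemma star_enum_inj : injective p.
Proof.
move=> r s prs; have [h _] := p_enum; apply/ord_inj/eqP.
by case: ltngtP => // /h; rewrite prs ltnn.
Qed.

Lemma lstar_enum r : lstar (tnth W (p r)).
Proof. by have [_ ->] := p_enum; apply: codom_f. Qed.

Lemma lstar_partner r : lstar (tnth W (q r)) = false.
Proof. by have [_ _ -> _] := pi_nc; rewrite lstar_enum. Qed.

Lemma partner_gt r : (p r < q r)%N.
Proof. by have [_ h _ _] := pi_nc; apply/h/lstar_enum. Qed.

Lemma partner_inj : injective q.
Proof.
by have [piK _ _ _] := pi_nc; move=> r s /(can_inj piK)/star_enum_inj.
Qed.

Lemma star_neq_partner r s : (p r == q s) = false.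
Proof. by apply/eqP => h; have := lstar_partner s; rewrite -h lstar_enum. Qed.

Lemma star_or_partner l : (exists r, l = p r) \/ (exists s, l = q s).
Proof.
have [_ stE] := p_enum; have [piK _ stpi _] := pi_nc.
case: (boolP (lstar (tnth W l))) => st.
  by left; move: st; rewrite stE => /codomP[r ->]; exists r.
right; have : lstar (tnth W (pi l)) by rewrite stpi.
by rewrite stE => /codomP[s E]; exists s; rewrite /q -E piK.
Qed.

Variables (A : comNzRingType) (a : nat -> A) (N : nat).

(* Labels and matching are prescribed on the positions before l by z0 and g. *)
Definition label_term (l : nat) (g : 'I_n -> 'I_n) (z0 : 'I_n -> 'I_N.+1)
    (z : {ffun 'I_n -> 'I_N.+1}) (s : 'S_n) : A :=
  (\prod_r (if (p r < l)%N then (z r == z0 r)%:R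
            else a (z r) ^+ (lexp (tnth W (p r))).+1)) *
  (\prod_r (if (q r < l)%N then (s r == g r)%:R
            else (word_edge W p pi (s r) r && (z (s r) == z r))%:R *
                 a (z r) ^+ lexp (tnth W (q r)))).

Definition label_sum l g z0 : A := \sum_z \sum_s label_term l g z0 z s.

Let ltS (i j : 'I_n.*2) : (i == j) = false -> (i < j.+1)%N = (i < j)%N.
Proof. by rewrite ltnS leq_eqVlt (inj_eq val_inj) => ->. Qed.

(** Past the position [p r] only the factor of the star [r] changes: its weight becomes the
    indicator of [z r == v], and the sum over [v] restores it. *)
Lemma label_sum_star g z0 r :
  label_sum (p r) g z0 = \sum_(v < N.+1)
    a v ^+ (lexp (tnth W (p r))).+1 *
      label_sum (p r).+1 g [eta z0 with r |-> v].
Proof.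
under [RHS]eq_bigr do rewrite mulr_sumr.
rewrite exchange_big; apply: eq_bigr => z _ /=.
under [RHS]eq_bigr do rewrite mulr_sumr.
rewrite exchange_big; apply: eq_bigr => s _ /=.
have E v : label_term (p r).+1 g [eta z0 with r |-> v] z s =
    (z r == v)%:R * (\prod_(i | i != r) (if (p i < p r)%N then (z i == z0 i)%:R
            else a (z i) ^+ (lexp (tnth W (p i))).+1) *
    \prod_i (if (q i < p r)%N then (s i == g i)%:R
            else (word_edge W p pi (s i) i && (z (s i) == z i))%:R *
                 a (z i) ^+ lexp (tnth W (q i)))).
  rewrite /label_term (bigD1 r) //= ltnSn eqxx -mulrA; congr (_ * (_ * _)).
    apply: eq_bigr => i /negPf ir.
    by rewrite ltS ?(inj_eq star_enum_inj) // ir.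
  by apply: eq_bigr => i _; rewrite ltS // eq_sym star_neq_partner.
rewrite (bigD1 (z r)) //= big1 ?addr0; last first.
  by move=> v /negPf vz; rewrite E eq_sym vz mul0r mulr0.
by rewrite E eqxx mul1r /label_term (bigD1 r) //= ltnn mulrA.
Qed.

(** Only the factor of the creator [q r] changes, and the sum over [b] selects [b = s r]. *)
Lemma label_sum_partner g z0 r :
  label_sum (q r) g z0 = \sum_b
    (word_edge W p pi b r && (z0 b == z0 r))%:R *
      (a (z0 r) ^+ lexp (tnth W (q r)) *
        label_sum (q r).+1 [eta g with r |-> b] z0).
Proof.
under [RHS]eq_bigr do rewrite mulrA mulr_sumr.
rewrite exchange_big; apply: eq_bigr => z _ /=.
under [RHS]eq_bigr do rewrite mulr_sumr.
rewrite exchange_big; apply: eq_bigr => s _ /=.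
set K := lexp _.
have E b : label_term (q r).+1 [eta g with r |-> b] z0 z s =
    (s r == b)%:R * ((\prod_i (if (p i < q r)%N then (z i == z0 i)%:R
            else a (z i) ^+ (lexp (tnth W (p i))).+1)) *
    \prod_(i | i != r) (if (q i < q r)%N then (s i == g i)%:R
            else (word_edge W p pi (s i) i && (z (s i) == z i))%:R *
                 a (z i) ^+ lexp (tnth W (q i)))).
  rewrite /label_term [X in _ * X](bigD1 r) //= ltnSn eqxx [RHS]mulrCA.
  congr (_ * (_ * _)).
    by apply: eq_bigr => i _; rewrite ltS // star_neq_partner.
  apply: eq_bigr => i /negPf ir.
  by rewrite ltS ?(inj_eq partner_inj) // ir.
rewrite (bigD1 (s r)) //= big1 ?addr0; last first.
  by move=> b /negPf bs; rewrite E [s r == b]eq_sym bs mul0r mulr0.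
rewrite E eqxx mul1r /label_term [X in _ * X](bigD1 r) //= ltnn.
(* If [z] differs from [z0] at an earlier star, both sides vanish. Otherwise [z0] replaces [z] in
   the factor of [r], as the edge condition puts the star [s r] before [q r]. *)
case: (boolP [forall i, (p i < q r)%N ==> (z i == z0 i)]); last first.
  case/forallPn => i; rewrite negb_imply => /andP[pi_lt /negPf zi].
  by rewrite (bigD1 i) //= pi_lt zi !mul0r mulr0.
move/forallP => zz0; have zE i : (p i < q r)%N -> z i = z0 i.
  by move=> h; apply/eqP/(implyP (zz0 i)).
rewrite mulrCA; congr (_ * _).
rewrite (zE r) ?partner_gt //; congr (_%:R * _).
by case: (boolP (word_edge _ _ _ _ _)) => //= /andP[_ /zE ->].
Qed.

(** No permutation takes the value [g r] at both [r] and [s]: a star already chosen cannot be chosen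
    again. *)
Lemma label_sum_used g z0 r s : (q r < q s)%N ->
  label_sum (q s).+1 [eta g with s |-> g r] z0 = 0.
Proof.
move=> rs; rewrite /label_sum; apply: big1 => z _; apply: big1 => t _.
have nrs : (r == s) = false by apply: contraTF rs => /eqP ->; rewrite ltnn.
rewrite /label_term [X in _ * X](bigD1 r) //= [X in _ * (_ * X)](bigD1 s) /=; last first.
  by rewrite eq_sym nrs.
rewrite nrs ltnS (ltnW rs) ltnSn eqxx.
case: eqP => [<-|_]; last by rewrite mul0r mulr0.
by rewrite (inj_eq perm_inj) eq_sym nrs mul0r !mulr0.
Qed.

(** Everything is prescribed, so only [z = z0] and [s = g] survive; injectivity makes [g] a
    permutation. *)
Lemma label_sum_end g z0 : injective g -> label_sum n.*2 g z0 = 1.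
Proof.
move=> g_inj; rewrite /label_sum (bigD1 (finfun z0)) //= [X in _ + X]big1 ?addr0; last first.
  move=> z zz0; apply: big1 => s _; have [i zi] : exists i, z i != z0 i.
    apply/existsP; rewrite -negb_forall; apply: contra zz0 => /forallP h.
    by apply/eqP/ffunP => i; rewrite ffunE; apply/eqP.
  by rewrite /label_term (bigD1 i) //= ltn_ord (negPf zi) !mul0r.
rewrite (bigD1 (perm g_inj)) //= big1 ?addr0; last first.
  move=> s sg; have [i si] : exists i, s i != g i.
    apply/existsP; rewrite -negb_forall; apply: contra sg => /forallP h.
    by apply/eqP/permP => i; rewrite permE; apply/eqP.
  by rewrite /label_term mulrC (bigD1 i) //= ltn_ord (negPf si) !mul0r.
rewrite /label_term !big1 ?mulr1 // => i _.
  by rewrite ltn_ord permE eqxx.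
by rewrite ltn_ord ffunE eqxx.
Qed.

(* X lists the stars before l whose creator is not yet chosen, Y those whose
   partner under pi comes later, most recent first. *)
Lemma wick_label_sum l g z0 (X Y : seq 'I_n) : (l <= n.*2)%N ->
  sorted (fun i j : 'I_n => j < i)%N Y ->
  (forall r, (r \in Y) = (p r < l <= q r)%N) ->
  {in [pred r | q r < l]%N &, injective g} ->
  (forall s, (q s < l)%N -> (p (g s) < l)%N) ->
  uniq X ->
  (forall r, (r \in X) =
     (p r < l)%N && ~~ [exists s, (q s < l)%N && (g s == r)]) ->
  wick (psum N) a (drop l W)
    [seq (nat_of_ord (z0 r), lcolor (tnth W (p r))) | r <- X]
    [seq nat_of_ord (z0 r) | r <- Y] = label_sum l g z0.
Proof.
move=> /subnKC; move: (_ - l)%N => d.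
elim: d l g z0 X Y => [|d IHd] l g z0 X Y ld Ysort memY ginj gl Xu memX.
  move: ld ginj memX {gl}; rewrite addn0 => -> ginj memX.
  have {}ginj : injective g by move=> r s; apply: ginj; rewrite inE /= ltn_ord.
  rewrite drop_oversize ?size_tuple //= label_sum_end //.
  (* An injective [g] is onto, so every star has been chosen and [X] is empty. *)
  case: X Xu memX => [|r X _ /(_ r)]; first by rewrite eqxx.
  rewrite mem_head ltn_ord /= => /esym/negP[]; apply/existsP.
  by exists (invF ginj r); rewrite ltn_ord f_invF eqxx.
have ln : (l < n.*2)%N by rewrite -ld addnS ltnS leq_addr.
pose lo := Ordinal ln.
rewrite (drop_nth (tnth W lo)) ?size_tuple // -[nth _ _ _]/(nth _ _ lo) -tnth_nth.
have ld1 : (l.+1 + d)%N = n.*2 by rewrite addSnnS.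
have [[r lr]|[s ls]] := star_or_partner lo.
- have lE : l = p r by rewrite -lr.
  have rX : r \notin X by rewrite memX lE ltnn.
  have rY : r \notin Y by rewrite memY lE ltnn.
  have qltS i : (q i < (p r).+1)%N = (q i < p r)%N.
    by rewrite ltS // eq_sym star_neq_partner.
  rewrite /= lr lstar_enum lE label_sum_star /psum; apply: eq_bigr => v _.
  congr (_ * _); rewrite -(IHd _ g _ (r :: X) (r :: Y)); first last.
  + move=> i; rewrite inE memX ltnS (leq_eqVlt (p i)) (inj_eq val_inj).
    rewrite (inj_eq star_enum_inj) lE; have [->|ir] := eqVneq i r => /=.
      symmetry; apply/existsPn => s; rewrite qltS.
      by apply/negP => /andP[+ /eqP gs]; rewrite -lE => /gl; rewrite gs lE ltnn.
    by under [in RHS]eq_existsb do rewrite qltS.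
  + by rewrite /= rX.
  + by move=> i; rewrite qltS -lE => /gl h; rewrite ltnS ltnW // -lE.
  + by move=> i j; rewrite !inE /= !qltS -lE; apply: ginj.
  + move=> i; rewrite inE memY lE ltnS (leq_eqVlt (p i)) (inj_eq val_inj).
    rewrite (inj_eq star_enum_inj); have [->|ir] /= := eqVneq i r.
      by rewrite partner_gt.
    by rewrite (leq_eqVlt (p r)) (inj_eq val_inj) star_neq_partner.
  + case: (Y) Ysort memY => //= t Y' -> /(_ t); rewrite mem_head andbT.
    move/esym/andP => [+ _]; rewrite lE => h.
    have [homo_p _] := p_enum; rewrite ltnNge; apply/negP.
    by rewrite leq_eqVlt => /orP[/eqP/val_inj E|/homo_p];
      [move: h; rewrite E ltnn|rewrite ltnNge (ltnW h)].
  + by rewrite -lE.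
  congr (wick _ _ _ _ _) => /=; rewrite eqxx; congr (_ :: _); apply/eq_in_map => i iX;
    by case: eqVneq => // ir; move: iX; rewrite ir ?(negPf rX) ?(negPf rY).
have lE : l = q s by rewrite -ls.
have pltS i : (p i < (q s).+1)%N = (p i < q s)%N by rewrite ltS ?star_neq_partner.
have sY : s \in Y by rewrite memY lE partner_gt leqnn.
case: Y Ysort memY sY => // t Y Ysort memY sY.
(* The top of the stack is the partner of the current creator: if [s] lay below [t], then
   [p s < p t < q s < q t] would be a crossing. *)
have ts : t = s.
  move: sY; rewrite inE => /predU1P[-> //|sY]; exfalso.
  have st : (s < t)%N.
    move: Ysort => /=; rewrite path_sortedE; last first.
      by move=> i j k ji ik; apply: ltn_trans ik ji.
    by case/andP => /allP/(_ _ sY).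
  have [homo_p _] := p_enum; have [_ _ _ /(_ (p s) (p t))/negP[]] := pi_nc.
  have := memY t; rewrite mem_head => /esym/andP[tl lt].
  rewrite homo_p // -lE tl /= lE ltn_neqAle -lE lt andbT lE.
  by rewrite (inj_eq val_inj) (inj_eq partner_inj) neq_ltn st.
have sNY : s \notin Y.
  apply/negP => sY'; move: Ysort; rewrite ts /= path_sortedE; last first.
    by move=> i j k ji ik; apply: ltn_trans ik ji.
  by case/andP => /allP/(_ _ sY'); rewrite ltnn.
have qltS i : i != s -> (q i < (q s).+1)%N = (q i < q s)%N.
  by move=> /negPf si; rewrite ltS ?(inj_eq partner_inj).
have Xlt i : i \in X -> (p i < q s)%N by rewrite memX lE => /andP[].
rewrite /= ls lstar_partner ts lE label_sum_partner.
set cz := (_, lcolor _); set K := _ * wick _ _ _ _ _.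
(* The multiplicity becomes a sum over the pending stars [b] that carry the required label and
   color. *)
rewrite count_map mulr_natl -iter_addr_0 -big_const_seq big_mkcond /= big_uniq //=.
(* A star outside [X] is either not before [q s], so there is no edge, or already chosen. *)
rewrite [RHS](bigID (mem X)) /= [X in _ + X]big1 ?addr0; last first.
  move=> b bX; have [|] := boolP (word_edge W p pi b s); last by rewrite mul0r.
  case/andP => _; rewrite -/(q s) => bs.
  move: bX; rewrite memX lE bs /= negbK => /existsP[r /andP[rs /eqP <-]].
  by rewrite label_sum_used // !mulr0.
apply: eq_bigr => b bX; rewrite /word_edge -/(q s) Xlt // andbT.
rewrite xpair_eqE (inj_eq val_inj) andbC.
case: ifP => [/andP[/eqP colb /eqP zb]|_]; last by rewrite mul0r.
rewrite mul1r /K; congr (_ * _); rewrite -(IHd _ _ _ (rem b X) Y); first last.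
+ move=> i; rewrite mem_rem_uniq // inE /= memX lE pltS.
  case: (p i < q s)%N; rewrite ?andbF //=.
  have [->|ib] /= := eqVneq i b.
    symmetry; apply/negbTE; rewrite negbK; apply/existsP; exists s.
    by rewrite ltnSn !eqxx.
  congr (~~ _); apply: eq_existsb => j; have [->|js] := eqVneq j s.
    by rewrite ltnn ltnSn /= eq_sym (negPf ib).
  by rewrite qltS.
+ exact: rem_uniq.
+ move=> i /=; have [_ _|si] := eqVneq i s; first by rewrite ltnS ltnW ?Xlt.
  by rewrite qltS // => h; rewrite ltnS ltnW // -lE gl // lE.
+ have bg i : (q i < q s)%N -> b != g i.
    move=> h; apply: contraTneq bX => ->; rewrite memX negb_and negbK.
    by apply/orP; right; apply/existsP; exists i; rewrite lE h eqxx.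
  move=> i j; rewrite !inE /=.
  have [->|si] := eqVneq i s; have [->|sj] := eqVneq j s => //.
  * by move=> _; rewrite qltS // => /bg /eqP.
  * by rewrite qltS // => /bg /eqP h _ /esym.
  * by rewrite !qltS // => hi hj; apply: ginj; rewrite inE /= lE.
+ move=> i; have := memY i; rewrite ts inE lE pltS => E.
  have [->|si] := eqVneq i s; first by rewrite (negPf sNY) ltnn andbF.
  move: E; rewrite (negPf si) /= => ->.
  rewrite (leq_eqVlt (q s)) (inj_eq val_inj) (inj_eq partner_inj).
  by rewrite eq_sym (negPf si).
+ exact: path_sorted Ysort.
+ by rewrite -lE.
(* [rem] may delete an equal entry coming from another star than [b], but the remaining multisets
   agree. *)
apply: wick_perm; rewrite -(perm_cons cz) -(permPl (perm_to_rem _)); last first.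
  by apply/mapP; exists b; rewrite // zb colb.
have -> : cz = (nat_of_ord (z0 b), lcolor (tnth W (p b))) by rewrite zb colb.
by rewrite -map_cons perm_map // perm_to_rem.
Qed.

(* In the matching given by s, the star r annihilates what the partner of s r
   created. *)
Lemma wick_word :
  wick (psum N) a W [::] [::] =
    \sum_(s : 'S_n | [forall r, word_edge W p pi r (s r)])
      \sum_(z : {ffun 'I_n -> 'I_N.+1})
        \prod_r ((z (s r) == z r)%:R * a (z r) ^+ word_weight W p pi r).
Proof.
have -> : wick (psum N) a W [::] [::] = label_sum 0 id (fun=> ord0).
  by rewrite -(@wick_label_sum _ _ _ [::] [::]) ?drop0 // => r; rewrite in_nil ltn0.
(* In [label_term] the permutation leads from creators to stars, against the arcs of the graph;
   hence the inversion. *)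
rewrite /label_sum exchange_big (reindex_inj invg_inj) /= [RHS]big_mkcond /=.
apply: eq_bigr => s _; case: ifP => [/forallP es|/negbT/forallPn[r er]]; last first.
  apply: big1 => z _; rewrite /label_term mulrC (bigD1 (s r)) //= permK (negPf er).
  by rewrite !mul0r.
apply: eq_bigr => z _; rewrite /label_term /= !big_split /=.
rewrite [X in _ * (X * _)](reindex_inj (@perm_inj _ s)) /=.
rewrite mulrCA; congr (_ * _).
  by apply: eq_bigr => r _; rewrite permK es eq_sym.
rewrite -big_split /=; apply: eq_bigr => r _.
by rewrite -exprD /word_weight addn1.
Qed.

End WordExpansion.

Local Open Scope classical_set_scope.
Local Open Scope complex_scope.

(** * Limits of truncated sums *)

Section Limits.
Variable R : realType.

Lemma cvg_psum (f : nat -> R) (l : R) :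
  series f @ \oo --> l -> psum N f @[N --> \oo] --> l.
Proof.
rewrite -(cvg_shiftS (series f)); apply: cvg_trans; apply: near_eq_cvg.
by apply: nearW => N; rewrite /series /= big_mkord.
Qed.

Lemma psum_le_lim (f : nat -> R) N : (forall z, 0 <= f z) ->
  cvgn (series f) -> psum N f <= limn (series f).
Proof.
move=> f0 cf; have -> : psum N f = series f N.+1 by rewrite /series /= big_mkord.
by apply: nondecreasing_cvgn_le => //; apply: nondecreasing_series.
Qed.

(* Tannery's theorem, in the case of a limit from below. *)
Lemma cvg_psum_le (f : nat -> nat -> R) (g : nat -> R) :
  (forall N z, 0 <= f N z <= g z) -> (forall z, f N z @[N --> \oo] --> g z) ->
  cvgn (series g) -> psum N (f N) @[N --> \oo] --> limn (series g).
Proof.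
move=> fg cf cg; have g0 z : 0 <= g z by case/andP: (fg 0%N z) => /le_trans; apply.
apply/cvgrPdist_lt => eps eps0; have eps2 : 0 < eps / 2 by rewrite divr_gt0.
(* [M] leaves a tail of [g] below [eps / 2], and [N0] brings the first [M] terms within [eps / 2];
   [psum N (f N)] lies between those terms and the limit. *)
have [M _ /(_ M (leqnn M)) /= gM] := (cvgrPdist_lt _ _).1 cg _ eps2.
have cM : \sum_(z < M) f N z @[N --> \oo] --> \sum_(z < M) g z.
  by apply: cvg_big => [|z _]; [exact: add_continuous|exact: cf].
have [N0 _ fM] := (cvgrPdist_lt _ _).1 cM _ eps2.
exists (maxn M N0) => // N /=; rewrite geq_max => /andP[MN /fM /=].
move: gM; rewrite /series /= big_mkord.
have le1 : \sum_(z < M) f N z <= psum N (f N).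
  rewrite /psum -!(big_mkord xpredT) [leRHS](big_cat_nat (n := M)) ?leqW //=.
  by rewrite lerDl sumr_ge0 // => z _; case/andP: (fg N z).
have le2 : psum N (f N) <= limn (series g).
  apply: le_trans (psum_le_lim N g0 cg); apply: ler_sum => z _.
  by case/andP: (fg N z).
move=> /ltr_normlP[h1 h2] /ltr_normlP[h3 h4]; rewrite ger0_norm ?subr_ge0 //.
move: h1 h2 h3 h4 le1 le2; set a := \sum_(_ < _) _; set b := psum _ _.
set c := limn _; set d := \sum_(_ < _) _; lra.
Qed.

End Limits.

(** * Convergence of the recursion *)

Section WickLimit.
Variables (R : realType) (alpha : nat -> R).
Hypothesis alpha_ge0 : forall i, 0 <= alpha i.
Hypothesis alpha_sum : series alpha @ \oo --> (1 : R).
Variable I : choiceType.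

Let lsum (f : nat -> R) : R := limn (series f).

Lemma alpha_le1 z : alpha z <= 1.
Proof.
have c : cvgn (series alpha) by apply/cvg_ex; exists 1.
have <- : limn (series alpha) = 1 by apply: cvg_lim => //; exact: norm_hausdorff.
apply: le_trans (psum_le_lim z alpha_ge0 c).
by rewrite /psum big_ord_recr /= lerDr sumr_ge0.
Qed.

(** Since [alpha z <= 1], the terms are dominated by [B * alpha z], whose sum is [B]. *)
Lemma weighted_series k (f : nat -> R) B : (forall z, 0 <= f z <= B) ->
  cvgn (series (fun z => alpha z ^+ k.+1 * f z)) /\
  0 <= lsum (fun z => alpha z ^+ k.+1 * f z) <= B.
Proof.
move=> fB; have f0 z : 0 <= f z by case/andP: (fB z).
have cB : series (fun z => B * alpha z) @ \oo --> B.
  have -> : series (fun z => B * alpha z) = (fun N => B * series alpha N).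
    by apply/funext => N; rewrite /series /= mulr_sumr.
  by rewrite -[X in _ --> X]mulr1; apply: cvgM; [exact: cvg_cst|exact: alpha_sum].
have icB : cvgn (series (fun z => B * alpha z)) by apply/cvg_ex; exists B.
have u0 z : 0 <= alpha z ^+ k.+1 * f z by rewrite mulr_ge0 ?exprn_ge0.
have uB z : alpha z ^+ k.+1 * f z <= B * alpha z.
  rewrite mulrC; apply: ler_pM; rewrite ?exprn_ge0 //; first by case/andP: (fB z).
  by rewrite exprS ler_piMr // exprn_ile1 ?alpha_le1.
have cu : cvgn (series (fun z => alpha z ^+ k.+1 * f z)).
  by apply: (series_le_cvg u0 _ uB icB) => z; apply: le_trans (uB z).
split=> //; apply/andP; split.
  by apply: limr_ge => //; apply: nearW => N; apply: sumr_ge0.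
apply: le_trans (lim_series_le cu icB uB) _.
by rewrite (cvg_lim _ cB) //; exact: norm_hausdorff.
Qed.

(** A bound uniform in the labels makes the nested series converge. Stars preserve it; a creator
    costs at most a factor [m], the number of pending labels, which is why the size is fixed. *)
Lemma wick_bounded (w : seq (letter I)) m : exists B, forall x y, size x = m ->
  0 <= wick lsum alpha w x y <= B.
Proof.
elim: w m => [|l w IHw] m; first by exists 1 => x y _ /=; rewrite ler0n lern1 leq_b1.
case: (boolP (lstar l)) => [st|/negPf st].
  have [B wB] := IHw m.+1; exists B => x y xm /=; rewrite st.
  by apply: (weighted_series _ _).2 => z; apply: wB; rewrite /= xm.
have [B wB] := IHw m.-1.
exists (m%:R * (Num.max 0 B)) => x [|z y] xm /=; rewrite st.
  by rewrite lexx mulr_ge0 ?ler0n // le_max lexx.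
have [zx|zx] := boolP ((z, lcolor l) \in x); last first.
  by rewrite (count_memPn zx) mul0r lexx mulr_ge0 ?ler0n // le_max lexx.
have /andP[w0 w1] : 0 <= wick lsum alpha w (rem (z, lcolor l) x) y <= B.
  by apply: wB; rewrite size_rem // xm.
have a0 : 0 <= alpha z ^+ lexp l by rewrite exprn_ge0.
rewrite !mulr_ge0 ?ler0n //= ler_pM ?ler0n ?mulr_ge0 //.
  by rewrite ler_nat -xm count_size.
rewrite le_max; apply/orP; right; apply: le_trans w1.
by rewrite ler_piMl // exprn_ile1 ?alpha_le1.
Qed.

Lemma wick_series_cvg (w : seq (letter I)) k i x y :
  cvgn (series (fun z => alpha z ^+ k.+1 * wick lsum alpha w ((z, i) :: x) (z :: y))).
Proof.
have [B wB] := wick_bounded w (size x).+1.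
by apply: (weighted_series _ _).1 => z; apply: wB.
Qed.

Lemma wick_psum_le (w : seq (letter I)) x y N :
  0 <= wick (psum N) alpha w x y <= wick lsum alpha w x y.
Proof.
elim: w x y => [|l w IHw] x y /=; first by rewrite ler0n lexx.
case: ifP => _.
  have w0 z : 0 <= alpha z ^+ (lexp l).+1 *
      wick (psum N) alpha w ((z, lcolor l) :: x) (z :: y).
    by rewrite mulr_ge0 ?exprn_ge0 //; case/andP: (IHw ((z, lcolor l) :: x) (z :: y)).
  have w1 z : alpha z ^+ (lexp l).+1 *
      wick (psum N) alpha w ((z, lcolor l) :: x) (z :: y) <= alpha z ^+ (lexp l).+1 *
      wick lsum alpha w ((z, lcolor l) :: x) (z :: y).
    rewrite ler_wpM2l ?exprn_ge0 //; by case/andP: (IHw ((z, lcolor l) :: x) (z :: y)).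
  rewrite sumr_ge0 //=; apply: le_trans (psum_le_lim N _ _).
  - exact: ler_sum.
  - by move=> z; apply: le_trans (w1 z).
  - exact: wick_series_cvg.
case: y => [|z y]; first by rewrite lexx.
have /andP[w0 w1] := IHw (rem (z, lcolor l) x) y.
by rewrite !mulr_ge0 ?ler0n ?exprn_ge0 //= !ler_wpM2l ?ler0n ?exprn_ge0.
Qed.

(** All nested sums are cut at the same [N], so at a star the summand varies with [N] too. It stays
    below its limit, and Tannery's theorem applies. *)
Lemma cvg_wick (w : seq (letter I)) x y :
  wick (psum N) alpha w x y @[N --> \oo] --> wick lsum alpha w x y.
Proof.
elim: w x y => [|l w IHw] x y /=; first exact: cvg_cst.
case: ifP => _.
  apply: cvg_psum_le => [N z|z|]; last exact: wick_series_cvg.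
    have /andP[w0 w1] := wick_psum_le w ((z, lcolor l) :: x) (z :: y) N.
    by rewrite mulr_ge0 ?exprn_ge0 //= ler_wpM2l ?exprn_ge0.
  by apply: cvgM; [exact: cvg_cst|exact: IHw].
case: y => [|z y]; first exact: cvg_cst.
by apply: cvgM; [exact: cvg_cst|apply: cvgM; [exact: cvg_cst|exact: IHw]].
Qed.

(** At exponent 1 the prescribed value 1 is the sum of the alphas. *)
Lemma cvg_power_sums k :
  psum N (fun i => alpha i ^+ k.+1) @[N --> \oo] --> power_sums alpha k.+1.
Proof.
apply: cvg_psum; case: k => [|k]; first exact: alpha_sum.
have [+ _] := @weighted_series k.+1 (fun=> 1) 1 (fun=> ltac:(by rewrite ler01 lexx)).
by under eq_fun do rewrite mulr1.
Qed.

End WickLimit.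

(** * From the operators to the recursion *)

Section OperatorWick.
Variables (R : realType) (alpha : nat -> R).
Hypothesis alpha_ge0 : forall i, 0 <= alpha i.
Hypothesis alpha_sum : series alpha @ \oo --> (1 : R).
Variables (H : hilbert R) (I : choiceType) (e : I -> H).
Hypothesis e_basis : orthonormal_basis e.

Let lsum (f : nat -> R) : R := limn (series f).

Lemma nsum_real (f : nat -> R) : cvgn (series f) ->
  nsum (fun z => (f z)%:C) = (lsum f)%:C.
Proof.
move=> cf; apply: cvg_lim; first exact: norm_hausdorff.
apply/cvgrPdist_lt => eps eps0.
have epsR : eps = (complex.Re eps)%:C by rewrite RRe_real // gtr0_real.
move: eps0; rewrite epsR ltcR => eps0.
have [M _ hM] := (cvgrPdist_lt _ _).1 cf _ eps0.
exists M => // N /hM /=.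
have -> : series (fun z => (f z)%:C) N = (series f N)%:C.
  by rewrite /series /= rmorph_sum.
by rewrite -rmorphB normc_def /= expr0n /= addr0 sqrtr_sqr ltcR.
Qed.

(** Restoring entry [j] at the end gives the whole list permuted by [lift_perm j ord_max s]. *)
Lemma perm_zip_tdel m (x : m.+1.-tuple nat) (c : m.+1.-tuple I) j (s : 'S_m) :
  perm_eq (zip (tact s (tdel j x)) (tact s (tdel j c)))
          (rem (tnth x j, tnth c j) (zip x c)).
Proof.
pose t := zip_tuple x c.
have tE i : tnth t i = (tnth x i, tnth c i).
  rewrite (tnth_nth (tnth x i, tnth c i)) nth_zip ?size_tuple //.
  by rewrite -!tnth_nth.
have tj : tnth t j \in zip x c by apply: mem_tnth t.
have -> : zip (tact s (tdel j x)) (tact s (tdel j c)) = tact s (tdel j t).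
  transitivity (zip_tuple (tact s (tdel j x)) (tact s (tdel j c)) : seq _) => //.
  congr tval; apply: eq_from_tnth => i; rewrite tnth_tact tnth_tdel tE.
  rewrite (tnth_nth (tnth x j, tnth c j)) nth_zip ?size_tuple //.
  by rewrite -!tnth_nth !tnth_tact !tnth_tdel.
rewrite -tE -(perm_cons (tnth t j)) -perm_rcons -(permPr (perm_to_rem tj)).
rewrite -[rcons _ _]/(tval (tsnoc _ _)) -tact_lift_perm.
by apply/tuple_permP; exists (lift_perm j ord_max s)^-1%g.
Qed.

(** The stack is [rev y] because the operators act at the right end of [y], while [wick] pushes at
    the head. *)
Lemma word_op_Omega w m (x y : m.-tuple nat) (c : m.-tuple I) :
  @word_op R alpha H I e w (@Omega R H) m x y (map_tuple e c) =
    (wick lsum alpha w (zip x c) (rev y))%:C.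
Proof.
elim: w m x y c => [|l w IHw] m x y c.
  rewrite /= /Omega -size_eq0 size_zip !size_tuple minnn.
  exact/esym/rmorph_nat.
rewrite /= /letter_op; case: (lstar l).
  rewrite /annihilation /annihilation_level -nsum_real; last exact: wick_series_cvg.
  congr nsum; apply/funext => z; rewrite rmorphM; congr (_ * _).
  have -> : tsnoc (map_tuple e c) (e (lcolor l)) = map_tuple e (tsnoc c (lcolor l)).
    by apply: val_inj; rewrite /= map_rcons.
  rewrite IHw /= rev_rcons zip_rcons ?size_tuple //; congr (_%:C).
  by apply: wick_perm; rewrite perm_rcons.
case: m x y c => [|m] x y c; first by rewrite (tuple0 y).
have -> : rev y = tlast y :: rev (tinit y) by rewrite -{1}(tsnocK y) /= rev_rcons.
set v := (tlast y, lcolor l).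
set K := _ * wick _ _ _ _ _.
(* The symmetrization splits by the position [j] moved to the end; the permutation [s] of the rest
   does not affect the value. *)
rewrite /creation /creation_level /symm (reindex_inj invg_inj) /= sum_lift_perm.
have E j (s : 'S_m) : UUop (lift_perm j ord_max s)^-1
      (append alpha (lexp l) (e (lcolor l)) (@word_op R alpha H I e w (@Omega R H) m))
      x y (map_tuple e c) = (((tnth x j, tnth c j) == v)%:R * K)%:C.
  rewrite /UUop invgK !tact_lift_perm /append !tlast_tsnoc !tinit_tsnoc.
  have -> : tact s (tdel j (map_tuple e c)) = map_tuple e (tact s (tdel j c)).
    by apply: eq_from_tnth => i; rewrite !(tnth_tact, tnth_tdel, tnth_map).
  rewrite IHw (wick_perm _ _ _ _ (perm_zip_tdel x c j s)) tnth_map e_basis.1.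
  rewrite xpair_eqE eq_sym [lcolor l == _]eq_sym.
  case: (tlast y =P tnth x j) => [yx|_]; last by rewrite mul0r.
  case: (tnth c j =P lcolor l) => [cl|_] /=; last by rewrite mul0r mulr0.
  by rewrite mulr1 mul1r -rmorphM /= /K /v yx cl.
under eq_bigr => j _.
  under eq_bigr => s _ do rewrite E.
  rewrite sumr_const card_Sn -[_ *+ m`!]mulr_natl.
  over.
(* The [m!] equal terms for each [j] and the factor [m + 1] cancel [(m + 1)!], leaving the number of
   matching positions [j]. *)
rewrite /= -mulr_sumr factS natrM invfM !mulrA mulfV ?pnatr_eq0 // mul1r.
rewrite mulVf ?mul1r ?pnatr_eq0 -?lt0n ?fact_gt0 // -rmorph_sum; congr (_%:C).
rewrite -mulr_suml -natr_sum -[RHS]mulrA -/K; congr (_%:R * _).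
have -> : zip x c = zip_tuple x c :> seq _ by [].
rewrite -sum1_count big_tuple [RHS]big_mkcond /=; apply: eq_bigr => j _.
rewrite (tnth_nth (tnth x j, tnth c j)) nth_zip ?size_tuple //.
by rewrite -!tnth_nth; case: eqP.
Qed.

End OperatorWick.

Theorem mainTheorem15 (R : realType) (alpha : nat -> R)
  (alpha_noninc : forall i, alpha i.+1 <= alpha i)
  (alpha_ge0 : forall i, 0 <= alpha i)
  (alpha_sum : series alpha @ \oo --> (1 : R))
  (H : hilbert R) (I : choiceType) (e : I -> H)
  (e_basis : orthonormal_basis e)
  (n : nat) (W : n.*2.-tuple (letter I)) (W_dyck : dyck_word W)
  (p : 'I_n -> 'I_n.*2) (p_enum : star_enum W p)
  (pi : 'I_n.*2 -> 'I_n.*2) (pi_nc : noncrossing_pairing W pi) :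
  rho alpha e (word_op alpha e W) =
    (cycle_indicator (word_edge W p pi) (word_weight W p pi)
       (power_sums alpha))%:C.
Proof.
rewrite rhoE.
have -> : [tuple] = map_tuple e [tuple] :> 0.-tuple H by apply: val_inj.
rewrite (word_op_Omega alpha_ge0 alpha_sum e_basis) conjc_real; congr (_%:C).
(* The truncations converge to the vacuum coefficient; by uniqueness of limits it remains to see
   that they converge to the cycle indicator. *)
have cW := @cvg_wick R alpha alpha_ge0 alpha_sum I W [::] [::].
apply: (cvg_unique _ cW); first exact: norm_hausdorff.
rewrite /= cycle_indicator_perm.
under eq_cvg do rewrite (wick_word p_enum pi_nc).
apply: cvg_big => [|s _]; first exact: add_continuous.
under eq_cvg do rewrite sum_constant_labelings.
apply: cvg_big => [|O /imsetP[r _ ->]]; first exact: mul_continuous.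
(* The orbit contains [r], of weight at least 1, so the exponent is a successor as [cvg_power_sums]
   requires. *)
rewrite (bigD1 r) ?porbit_id //= /word_weight addn1 !addSn.
exact: cvg_power_sums.
Qed.
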